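(* Let $1\le k\le n$ be integers, let $M\in\mathbb{R}^{2n\times 2n}$ be symmetric positive definite with symplectic eigenvalues $d_1\le d_2\le\cdots\le d_n$, let $N=\operatorname{diag}(\nu_1,\ldots,\nu_k)$ with $0<\nu_1<\nu_2<\cdots<\nu_k$, and let $\tilde N=\operatorname{diag}(N,N)$. Then $$2(d_1\nu_k+d_2\nu_{k-1}+\cdots+d_k\nu_1)=\min_{X\in\mathbb{R}^{2n\times 2k}}\operatorname{tr}(\tilde N X^TMX)\quad\text{subject to}\quad X^TJ_{2n}X=J_{2k},$$ and the minimum is attained. Moreover, the columns of any minimizer $X_*$ consist of $k$ symplectic eigenvector pairs of $M$ associated with the smallest $k$ symplectic eigenvalues of $M$ arranged in nonincreasing order, i.e., $X_*$ is a symplectic eigenvector set of $M$ and $X_*^TMX_*=\operatorname{diag}(d_k,\ldots,d_1,d_k,\ldots,d_1)$.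
   Context: $J_{2m}=\begin{bmatrix}0 & I_m\\ -I_m & 0\end{bmatrix}$. A matrix $S\in\mathbb{R}^{2n\times 2n}$ is symplectic if $S^TJ_{2n}S=J_{2n}$. By Williamson's theorem there is a symplectic $S$ with $S^TMS=\operatorname{diag}(D,D)$, $D=\operatorname{diag}(d_1,\ldots,d_n)$, $d_j>0$; the $d_j$ are the symplectic eigenvalues of $M$. Writing $S=[s_1,\ldots,s_{2n}]$, the pair $[s_j,s_{n+j}]$ is a symplectic eigenvector pair associated with $d_j$. For a $k$-tuple $\mathcal I_k=[i_1,\ldots,i_k]$ of distinct indices in $\{1,\ldots,n\}$, $S_{\mathcal I_k}=[s_{i_1},\ldots,s_{i_k},s_{n+i_1},\ldots,s_{n+i_k}]$; a matrix $X\in\mathbb{R}^{2n\times 2k}$ is a symplectic eigenvector set of $M$ (associated with $d_{i_1},\ldots,d_{i_k}$) if $X=S_{\mathcal I_k}$ for some such Williamson diagonalizer $S$ and some such $\mathcal I_k$. *)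

(* Defs.v *)
From HB Require Import structures.
From mathcomp Require Import all_boot all_order all_algebra.
From mathcomp Require Import reals.
Set Implicit Arguments. Unset Strict Implicit. Unset Printing Implicit Defensive.
Import Order.TTheory GRing.Theory Num.Theory.
Local Open Scope ring_scope.

Definition Jmx (R : ringType) (m : nat) : 'M[R]_(m + m) :=
  block_mx 0 1%:M (- 1%:M) 0.

Definition symplectic (R : ringType) (n : nat) (S : 'M[R]_(n + n)) : Prop :=
  S^T *m Jmx R n *m S = Jmx R n.

Definition diag2 (R : ringType) (m : nat) (d : nat -> R) : 'M[R]_(m + m) :=
  let D := diag_mx (\row_(i < m) d i) in block_mx D 0 0 D.

Definition symmetric_mx (R : ringType) (m : nat) (M : 'M[R]_m) : Prop := M^T = M.

Definition posdef_mx (R : numDomainType) (m : nat) (M : 'M[R]_m) : Prop :=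
  symmetric_mx M /\ forall x : 'cV[R]_m, x != 0 -> 0 < (x^T *m M *m x) 0 0.

Definition williamson (R : numDomainType) (n : nat) (M S : 'M[R]_(n + n))
    (d : nat -> R) : Prop :=
  symplectic S /\ S^T *m M *m S = diag2 n d.

Definition symp_eigenvalues (R : numDomainType) (n : nat) (M : 'M[R]_(n + n))
    (d : nat -> R) : Prop :=
  (forall i, (i < n)%N -> 0 < d i) /\
  (forall i j, (i <= j < n)%N -> d i <= d j) /\
  exists S, williamson M S d.

Definition col_index (n k : nat) (I : 'I_k -> 'I_n) (c : 'I_(k + k)) : 'I_(n + n) :=
  match split c with
  | inl j => lshift n (I j)
  | inr j => rshift n (I j)
  end.

Definition SI (R : ringType) (n k : nat) (S : 'M[R]_(n + n)) (I : 'I_k -> 'I_n)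
  : 'M[R]_(n + n, k + k) := colsub (col_index I) S.

(* Main.v *)
(* Writing X = S Y with S a Williamson diagonalizer reduces the problem to
   M = D = diag(d, d).  Split Y = P + Q into its parts commuting and anticommuting
   with J; then P^T P = 1 + Q^T Q, the trace functional is the sum of its values
   at P and Q, and the value at Q is nonnegative, vanishing only for Q = 0.  For P,
   a Ky Fan inequality bounds below the contribution of any m pairs of columns by
   2 (d_1 + ... + d_m), and Abel summation against the increasing weights nu gives
   the bound.  At a minimizer Q = 0, so Y is an isometry commuting with J, and all
   the Ky Fan bounds are attained on the last m columns: the j-th column has
   Rayleigh quotient d_(k+1-j).  Column after column, starting from the last one,
   complex Householder reflections commuting with J and D move the columns to
   standard basis vectors, and their product turns S into the required
   diagonalizer. *)
Require Import Defs.
From HB Require Import structures.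
From mathcomp Require Import all_boot all_order all_algebra.
From mathcomp Require Import reals.
From mathcomp Require Import ring lra zify.
Import Order.TTheory GRing.Theory Num.Theory.
Local Open Scope ring_scope.

(** * Gram matrices, a Ky Fan inequality and Abel summation *)

Lemma gram_diag_ge0 {R : realFieldType} {p q : nat} (A : 'M[R]_(p, q)) i :
  0 <= (A *m A^T) i i.
Proof.
by rewrite mxE sumr_ge0 // => j _; rewrite mxE -expr2 sqr_ge0.
Qed.

Lemma gram_diag_eq0 {R : realFieldType} {p q : nat} (A : 'M[R]_(p, q)) i j :
  (A *m A^T) i i = 0 -> A i j = 0.
Proof.
rewrite mxE => /psumr_eq0P h.
have /h/(_ j isT) : forall l, true -> 0 <= A i l * A^T l i.
  by move=> l _; rewrite mxE -expr2 sqr_ge0.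
by rewrite mxE => /eqP; rewrite -expr2 sqrf_eq0 => /eqP.
Qed.

Lemma gram_eq0 {R : realFieldType} {p : nat} (v : 'rV[R]_p) :
  v *m v^T = 0 -> v = 0.
Proof.
move=> h; apply/rowP => j; rewrite mxE.
by apply: gram_diag_eq0; rewrite h mxE.
Qed.

(** A row vector v in the left kernel satisfies |v|^2 + |v Q^T|^2 = 0, hence v = 0. *)
Lemma unitmx_add1_gram {R : realFieldType} {q r : nat} (Q : 'M[R]_(r, q)) :
  1%:M + Q^T *m Q \in unitmx.
Proof.
rewrite -row_free_unit; apply: inj_row_free => v vG.
apply: gram_eq0; apply/matrixP => i j; rewrite [i]ord1 [j]ord1 [RHS]mxE.
have : (v *m (1%:M + Q^T *m Q) *m v^T) 0 0 = 0 by rewrite vG mul0mx mxE.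
rewrite mulmxDr mulmx1 mulmxDl [LHS]mxE -!mulmxA.
have -> : Q *m v^T = (v *m Q^T)^T by rewrite trmx_mul trmxK.
rewrite mulmxA => h; apply: le_anti.
by rewrite gram_diag_ge0 andbT -h lerDl gram_diag_ge0.
Qed.

(* With [G = P^T P], the matrix [Pi = P G^-1 P^T] is an orthogonal projector of
   trace [q] whose diagonal is dominated by that of [P P^T].  The sharp choice is
   [e i = max(0, t - d i)]; with [t] the [q]-th smallest entry of [d], the bound is
   then the sum of the [q] smallest entries. *)
Lemma ky_fan_ge {R : realFieldType} {p q r : nat} (P : 'M[R]_(p, q))
    (Q : 'M[R]_(r, q)) (d : 'rV[R]_p) (e : 'I_p -> R) (t : R) :
  P^T *m P = 1%:M + Q^T *m Q ->
  (forall i, 0 <= d 0 i) -> (forall i, 0 <= e i) ->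
  (forall i, t - d 0 i <= e i) ->
  t *+ q - \sum_i e i <= \tr (P^T *m diag_mx d *m P).
Proof.
move=> PP d0 e0 te.
set G := 1%:M + Q^T *m Q in PP.
have Gu : G \in unitmx by exact: unitmx_add1_gram.
have GT : G^T = G by rewrite /G linearD /= trmx1 trmx_mul trmxK.
have GiT : (invmx G)^T = invmx G by rewrite trmx_inv GT.
pose Pi := P *m invmx G *m P^T.
have PiT : Pi^T = Pi by rewrite /Pi !trmx_mul trmxK GiT mulmxA.
have Pi2 : Pi *m Pi^T = Pi.
  by rewrite PiT /Pi -!mulmxA (mulmxA P^T P) PP mulKVmx.
have trPi : \tr Pi = q%:R.
  by rewrite /Pi mxtrace_mulC mulmxA PP mulmxV // mxtrace1.
have Pi0 i : 0 <= Pi i i by rewrite -Pi2 gram_diag_ge0.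
have Pi1 i : Pi i i <= 1.
  have : (1%:M - Pi) *m (1%:M - Pi)^T = 1%:M - Pi.
    rewrite linearB /= trmx1 PiT mulmxBl mul1mx mulmxBr mulmx1.
    by rewrite -{4}PiT Pi2 subrr subr0.
  move/matrixP/(_ i i) => h.
  have := gram_diag_ge0 (1%:M - Pi) i.
  by rewrite h !mxE eqxx subr_ge0.
have Pile i : Pi i i <= (P *m P^T) i i.
  (* With K = Q^T Q = G - 1, one has 1 - G^-1 = G^-1 (K + K^2) G^-1, because K + K^2 = G K. Both
     summands give Gram matrices. *)
  have E : P *m P^T - Pi =
      (P *m invmx G *m Q^T) *m (P *m invmx G *m Q^T)^T
    + (P *m invmx G *m Q^T *m Q) *m (P *m invmx G *m Q^T *m Q)^T.
    rewrite !trmx_mul !trmxK GiT -!mulmxA.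
    rewrite -mulmxDr -mulmxDr.
    rewrite (mulmxA Q^T Q (invmx G *m _)) (mulmxA Q^T Q (Q^T *m Q *m _)).
    set K := Q^T *m Q.
    have -> : K *m (invmx G *m P^T) + K *m (K *m (invmx G *m P^T)) = G *m
      (K *m (invmx G *m P^T)).
      by rewrite /G -/K mulmxDl mul1mx.
    rewrite mulKmx //.
    have -> : K = G - 1%:M by rewrite /G addrC addKr.
    by rewrite mulmxBl mul1mx mulKVmx // mulmxBr /Pi -!mulmxA.
  have -> : (P *m P^T) i i = (P *m P^T - Pi : 'M_p) i i + Pi i i.
    by rewrite [(_ - Pi : 'M_p) i i]mxE [(- Pi : 'M_p) i i]mxE subrK.
  by rewrite lerDr E mxE addr_ge0 ?gram_diag_ge0.
rewrite -mulmxA mxtrace_mulC -mulmxA /mxtrace.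
have -> : t *+ q = \sum_i t * Pi i i.
  by rewrite -mulr_sumr -[\sum_i _]/(\tr Pi) trPi mulr_natr.
rewrite -sumrB; apply: ler_sum => i _.
rewrite mul_diag_mx [leRHS]mxE.
(* Entrywise, t Pi_ii - e_i <= d_i Pi_ii <= d_i (P P^T)_ii, the first inequality because (t - d_i)
   Pi_ii <= e_i Pi_ii <= e_i. *)
have h1 : d 0 i * Pi i i <= d 0 i * (P *m P^T) i i by rewrite ler_wpM2l.
have h2 : (t - d 0 i) * Pi i i <= e i * Pi i i by rewrite ler_wpM2r.
have h3 : e i * Pi i i <= e i * 1 by rewrite ler_wpM2l.
lra.
Qed.

(** With S_i the i-th partial sum of [F], Abel summation writes the weighted sum as w_m S_(m+1) plus
    the terms (w_i - w_(i+1)) S_(i+1). All of these are nonnegative with positive coefficients, so a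
    nonpositive total forces every S_i to vanish. *)
Lemma abel_ge0 {R : realFieldType} (w F : nat -> R) (m : nat) :
  (forall i, (i <= m)%N -> 0 < w i) ->
  (forall i, (i < m)%N -> w i.+1 < w i) ->
  (forall i, (i <= m.+1)%N -> 0 <= \sum_(j < i) F j) ->
  w m * (\sum_(j < m.+1) F j) <= \sum_(j < m.+1) w j * F j /\
  (\sum_(j < m.+1) w j * F j <= 0 ->
   forall i, (i <= m.+1)%N -> \sum_(j < i) F j = 0).
Proof.
elim: m => [|m IH] w0 wd F0.
  split=> [|h [|[|i]] // _]; rewrite ?big_ord0 //.
    by rewrite !big_ord_recl !big_ord0 !addr0.
  have := F0 1%N isT; have := w0 0%N isT.
  move: h; rewrite !big_ord_recl !big_ord0 !addr0 /= => h w0' F0'.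
  apply: le_anti; rewrite F0' andbT.
  by move: h; rewrite pmulr_rle0.
have [|||IH1 IH2] := IH.
- by move=> i im; apply: w0; apply: leqW.
- by move=> i im; apply: wd; apply: leqW.
- by move=> i im; apply: F0; apply: leqW.
have s0 := F0 m.+1 (leqnSn _).
have s1 := F0 m.+2 (leqnn _).
have wm := w0 m.+1 (leqnn _).
have wdm := wd m (leqnn _).
rewrite !(big_ord_recr m.+1) /= in s1 *.
set s := \sum_(j < m.+1) F j in IH1 s0 s1 *.
set z := \sum_(j < m.+1) _ in IH1 IH2 *.
(* By [IH1] the new weighted sum is at least the sum of the two quantities in [A] and [B]; if it is
   nonpositive, both are zero. *)
have A : 0 <= (w m - w m.+1) * s by rewrite mulr_ge0 // subr_ge0 ltW.
have B : 0 <= w m.+1 * (s + F m.+1) by rewrite mulr_ge0 // ltW.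
split; first by lra.
move=> h i; rewrite leq_eqVlt => /predU1P [-> | ].
  rewrite big_ord_recr /= -/s.
  have : w m.+1 * (s + F m.+1) = 0 by lra.
  by move/eqP; rewrite mulf_eq0 (gt_eqF wm) => /eqP.
rewrite ltnS; apply: IH2.
have C : 0 <= w m * s by rewrite mulr_ge0 // (le_trans (ltW wm) (ltW wdm)).
have : (w m - w m.+1) * s = 0 by lra.
move/eqP; rewrite mulf_eq0 subr_eq0 (gt_eqF wdm) /= => /eqP s00.
by move: h B; rewrite s00 !add0r; lra.
Qed.

(** * Polarization, complex structures and Householder reflections *)

Lemma parallelogram_mx {R : comNzRingType} {p q : nat} (A B : 'M[R]_(p, q))
    (C : 'M[R]_p) :
  (A - B)^T *m C *m (A - B) + (A + B)^T *m C *m (A + B) =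
  (A^T *m C *m A + B^T *m C *m B) *+ 2.
Proof.
rewrite [(A - B)^T]linearB [(A + B)^T]linearD /=
  !(mulmxDl, mulNmx, mulmxDr, mulmxN).
move: (A^T *m C *m A) (A^T *m C *m B) (B^T *m C *m A) (B^T *m C *m B).
by move=> Z1 Z2 Z3 Z4; apply/matrixP => i j; rewrite !mxE; ring.
Qed.

Lemma polarization_mx {R : comNzRingType} {p q : nat} (A B : 'M[R]_(p, q)) :
  (A - B)^T *m (A - B) =
  (A + B)^T *m (A + B) - (A^T *m B + B^T *m A) *+ 2.
Proof.
rewrite [(A - B)^T]linearB [(A + B)^T]linearD /=
  !(mulmxDl, mulNmx, mulmxDr, mulmxN).
move: (A^T *m A) (A^T *m B) (B^T *m A) (B^T *m B).
by move=> Z1 Z2 Z3 Z4; apply/matrixP => i j; rewrite !mxE; ring.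
Qed.

(** Together the equations make [J] orthogonal: it acts as the imaginary unit, and commuting with it
    means being complex linear. *)
Definition cplx_structure {R : nzRingType} {p : nat} (J : 'M[R]_p) :=
  J^T = - J /\ J *m J = - 1%:M.

(* The complex Householder reflection [v |-> v - w (w^* v) / (w^* x)],
   [w = x - y], where the complex scalars act through [J]. *)
Lemma householder {R : realFieldType} {p : nat} (J D : 'M[R]_p)
    (x y : 'cV[R]_p) (c : R) :
  cplx_structure J -> D^T = D -> D *m J = J *m D ->
  x^T *m x = 1%:M -> y^T *m y = 1%:M -> D *m x = c *: x -> D *m y = c *: y ->
  exists V : 'M[R]_p, [/\ V^T *m V = 1%:M, V *m J = J *m V, V *m D = D *m V,
    V *m x = y & forall z : 'cV[R]_p,
      (x - y)^T *m z = 0 -> (x - y)^T *m J *m z = 0 -> V *m z = z].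
Proof.
move=> [JT JJ] DT DJ xx yy Dx Dy.
have [->|xy] := eqVneq x y.
  exists 1%:M; split; rewrite ?trmx1 ?mul1mx ?mulmx1 // => z _ _.
  by rewrite mul1mx.
have [w Ew] : {w | w = x - y} by exists (x - y).
rewrite -Ew.
have Dw : D *m w = c *: w by rewrite Ew mulmxBr Dx Dy scalerBr.
have wD : w^T *m D = c *: w^T by rewrite -{1}DT -trmx_mul Dw linearZ.
(* Since J^T = - J, this is w w^T + (J w)(J w)^T, the real form of the complex rank-one map v -> w
   (w^* v). *)
pose H := w *m w^T - J *m w *m w^T *m J.
have JHJ : J *m H = H *m J.
  rewrite /H mulmxBr mulmxBl !mulmxA JJ !mulNmx mul1mx.
  by rewrite -!mulmxA JJ !mulmxN !mulmxA mulmx1 !opprK addrC.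
have HT : H^T = H.
  by rewrite /H linearB /= !trmx_mul trmxK JT !mulNmx !mulmxN opprK !mulmxA.
have HD : H *m D = D *m H.
  rewrite /H mulmxBl mulmxBr; congr (_ - _).
    by rewrite -mulmxA wD mulmxA Dw -scalemxAl -scalemxAr.
  rewrite -!mulmxA -DJ (mulmxA w^T) wD !mulmxA DJ -(mulmxA J D w) Dw.
  by rewrite -!scalemxAr -!scalemxAl.
have wJw : w^T *m J *m w = 0.
  apply/matrixP => i j; rewrite [i]ord1 [j]ord1 [RHS]mxE.
  have : (w^T *m J *m w)^T = - (w^T *m J *m w).
    by rewrite !trmx_mul trmxK JT !mulNmx !mulmxN mulmxA.
  by move/matrixP/(_ 0 0); rewrite mxE [RHS]mxE => ?; lra.
pose s := (w^T *m w) 0 0.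
have ws : w^T *m w = s%:M by rewrite [LHS]mx11_scalar.
have HH : H *m H = s *: H.
  rewrite {2}/H mulmxBr !mulmxA -JHJ -(mulmxA J H w).
  have -> : H *m w = s *: w.
    rewrite /H mulmxBl -!mulmxA ws (mulmxA w^T J) wJw !mulmx0 subr0.
    by rewrite mul_mx_scalar.
  by rewrite -!scalemxAr -!scalemxAl -scalerBr.
(* The complex number w^* x is a + i b, so [H] sends x to w times that number. *)
pose a := (w^T *m x) 0 0; pose b := - (w^T *m J *m x) 0 0.
have wa : w^T *m x = a%:M by rewrite [LHS]mx11_scalar.
have wb : w^T *m J *m x = (- b)%:M by rewrite [LHS]mx11_scalar opprK.
have Hx : H *m x = a *: w + b *: (J *m w).
  rewrite /H mulmxBl -!mulmxA wa (mulmxA w^T) wb !mul_mx_scalar -scalemxAr.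
  by rewrite scaleNr opprK.
(* For unit vectors x and y, |x - y|^2 is twice the real part of w^* x. Thus a > 0, and w^* x can be
   inverted. *)
have s2a : s = 2 * a.
  have xyyx : (y^T *m x) 0 0 = (x^T *m y) 0 0.
    by rewrite -[x^T *m y]trmxK trmx_mul trmxK [in RHS]mxE.
  rewrite /s /a Ew [(x - y)^T]linearB /= !(mulmxBl, mulmxBr) xx yy.
  move: xyyx; move: (y^T *m x) (x^T *m y) => Z1 Z2 Z12.
  by rewrite !mxE Z12; ring.
have s0 : 0 < s.
  rewrite /s lt_def; apply/andP; split; last first.
    by have := gram_diag_ge0 w^T 0; rewrite trmxK.
  apply: contra_neq xy => s00; apply/eqP; rewrite -subr_eq0 -Ew; apply/eqP.
  by apply: trmx_inj; rewrite trmx0; apply: gram_eq0; rewrite trmxK ws /s s00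
    raddf0.
have a0 : 0 < a by lra.
pose N := a ^+ 2 + b ^+ 2.
have N0 : N != 0 by rewrite gt_eqF // ltr_wpDr ?sqr_ge0 // exprn_gt0.
(* The inverse of a + i b, with i acting as [J]. *)
pose T := (a / N)%:M - (b / N) *: J.
have TC Z : Z *m J = J *m Z -> T *m Z = Z *m T.
  by move=> ZJ; rewrite mulmxBl mulmxBr -scalemxAl -scalemxAr scalar_mxC ZJ.
have TJ := TC J erefl.
have TH := TC H (esym JHJ).
have TD := TC D DJ.
have TTE : T^T = (a / N)%:M + (b / N) *: J.
  by rewrite linearB /= tr_scalar_mx linearZ /= JT scalerN opprK.
have HTT : H *m T^T = T^T *m H.
  by rewrite -[in LHS]HT -trmx_mul TH trmx_mul HT.
have VC Z : T *m Z = Z *m T -> H *m Z = Z *m H ->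
    (1%:M - T *m H) *m Z = Z *m (1%:M - T *m H).
  move=> TZ HZ; rewrite mulmxBl [Z *m (1%:M - _)]mulmxBr mul1mx mulmx1.
  by rewrite -mulmxA HZ !mulmxA TZ.
exists (1%:M - T *m H); split.
- have sub1M (A B : 'M[R]_p) :
      (1%:M - A) *m (1%:M - B) = 1%:M - B - A + A *m B.
    by rewrite mulmxBl !mulmxBr !mul1mx mulmx1 opprB addrA addrAC.
  rewrite [(1%:M - _)^T]linearB /= trmx1 trmx_mul HT sub1M.
  (* Here H^2 = s H and T^T T = 1/N. The quadratic term cancels the linear ones, because T + T^T is
     the scalar 2 a / N = s / N. *)
  have -> : H *m T^T *m (T *m H) = (s / N) *: H.
    have -> : H *m T^T *m (T *m H) = T^T *m T *m (H *m H).
      by rewrite HTT -!mulmxA; congr (_ *m _); rewrite !mulmxA -TH.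
    rewrite HH -scalemxAr.
    have -> : T^T *m T = (N^-1)%:M.
      rewrite TTE mulmxDl !mulmxBr !(mul_scalar_mx, mul_mx_scalar).
      rewrite -scalemxAl -scalemxAr JJ.
      apply/matrixP => i j; rewrite !mxE.
      by case: eqVneq => _; rewrite /N; field.
    by rewrite mul_scalar_mx scalerA.
  have -> : (s / N) *: H = T *m H + H *m T^T.
    rewrite HTT -mulmxDl -mul_scalar_mx; congr (_ *m _).
    rewrite TTE /T addrACA [- _ + _]addrC subrr addr0 -raddfD /= s2a.
    by congr _%:M; ring.
  by rewrite -(addrA 1%:M) -opprD subrK.
- exact: VC.
- exact: VC.
- rewrite mulmxBl mul1mx -mulmxA Hx.
  have -> : T *m (a *: w + b *: (J *m w)) = w.
    rewrite mulmxBl mul_scalar_mx -scalemxAl mulmxDr -!scalemxAr (mulmxA J J).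
    rewrite JJ mulNmx mul1mx.
    move: (J *m w) => Jw; apply/matrixP => i j; rewrite !mxE /N.
    by field; rewrite -/N.
  by rewrite Ew opprB addrC subrK.
- move=> z h1 h2; have Hz : H *m z = 0.
    by rewrite /H mulmxBl -!mulmxA h1 (mulmxA w^T) h2 !mulmx0 subr0.
  by rewrite mulmxBl mul1mx -mulmxA Hz mulmx0 subr0.
Qed.

(** * The standard complex structure, doubled diagonals and index pairs *)

Lemma Jmx_cplx {R : comNzRingType} {m : nat} : cplx_structure (Jmx R m).
Proof.
split; rewrite /Jmx.
  rewrite tr_block_mx opp_block_mx !trmx0 trmx1 linearN /= trmx1.
  by rewrite !oppr0 opprK.
rewrite mulmx_block !(mul0mx, mulmx0, mulNmx, mulmxN, mulmx1, add0r, addr0).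
by rewrite (scalar_mx_block m m 1) opp_block_mx !oppr0.
Qed.

Lemma diag2E {R : nzRingType} {m : nat} (d : nat -> R) :
  diag2 m d = diag_mx (row_mx (\row_(i < m) d i) (\row_(i < m) d i)).
Proof. by rewrite diag_mx_row. Qed.

Lemma diag2_Jmx {R : comNzRingType} {m : nat} (d : nat -> R) :
  diag2 m d *m Jmx R m = Jmx R m *m diag2 m d.
Proof.
rewrite /diag2 /Jmx !mulmx_block !(mul0mx, mulmx0, add0r, addr0).
by rewrite !(mulmx1, mul1mx, mulmxN, mulNmx).
Qed.

Lemma Jmx_delta {R : comNzRingType} {m : nat} (j : 'I_m) :
  Jmx R m *m delta_mx (lshift m j) (0 : 'I_1) = - delta_mx (rshift m j) 0.
Proof.
apply/colP => i; rewrite -colE mxE /Jmx; case: (split_ordP i) => a ->.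
  by rewrite block_mxEul !mxE eq_lrshift oppr0.
by rewrite block_mxEdl !mxE eq_rshift andbT.
Qed.

Lemma gram_colsub {R : comNzRingType} {p q r : nat} (g : 'I_r -> 'I_q)
    (A : 'M[R]_(p, q)) (M : 'M[R]_p) :
  (colsub g A)^T *m M *m colsub g A = mxsub g g (A^T *m M *m A).
Proof.
by rewrite trmx_mxsub mxsub_mul -[in RHS]mul_rowsub_mx.
Qed.

Lemma col_indexL {n k : nat} (I : 'I_k -> 'I_n) a :
  col_index I (lshift k a) = lshift n (I a).
Proof.
rewrite /col_index; case: split_ordP => b /eqP.
  by rewrite eq_lshift => /eqP ->.
by rewrite eq_lrshift.
Qed.

Lemma col_indexR {n k : nat} (I : 'I_k -> 'I_n) a :
  col_index I (rshift k a) = rshift n (I a).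
Proof.
rewrite /col_index; case: split_ordP => b /eqP.
  by rewrite eq_rlshift.
by rewrite eq_rshift => /eqP ->.
Qed.

Lemma col_index_inj {n k : nat} (I : 'I_k -> 'I_n) :
  injective I -> injective (col_index I).
Proof.
move=> Iinj i j.
case: (split_ordP i) => a ->; case: (split_ordP j) => b ->;
  rewrite ?col_indexL ?col_indexR => /eqP.
- by rewrite eq_lshift => /eqP/Iinj ->.
- by rewrite eq_lrshift.
- by rewrite eq_rlshift.
- by rewrite eq_rshift => /eqP/Iinj ->.
Qed.

Lemma mxsub_Jmx {R : nzRingType} {n k : nat} (I : 'I_k -> 'I_n) :
  injective I -> mxsub (col_index I) (col_index I) (Jmx R n) = Jmx R k.
Proof.
move=> Iinj; apply/matrixP => i j; rewrite mxE /Jmx.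
case: (split_ordP i) => a ->; case: (split_ordP j) => b ->;
  rewrite ?col_indexL ?col_indexR.
- by rewrite !block_mxEul !mxE.
- by rewrite !block_mxEur !mxE inj_eq.
- by rewrite !block_mxEdl !mxE inj_eq.
- by rewrite !block_mxEdr !mxE.
Qed.

Lemma mxsub_diag2 {R : nzRingType} {n k : nat} (I : 'I_k -> 'I_n)
    (d e : nat -> R) :
  injective I -> (forall j, d (I j) = e j) ->
  mxsub (col_index I) (col_index I) (diag2 n d) = diag2 k e.
Proof.
move=> Iinj dI; apply/matrixP => i j; rewrite mxE /diag2.
case: (split_ordP i) => a ->; case: (split_ordP j) => b ->;
  rewrite ?col_indexL ?col_indexR.
- by rewrite !block_mxEul !mxE inj_eq // dI.
- by rewrite !block_mxEur !mxE.
- by rewrite !block_mxEdl !mxE.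
- by rewrite !block_mxEdr !mxE inj_eq // dI.
Qed.

(** * Traces, and the splitting into linear and antilinear parts *)

Lemma mxtrace_diag2_mul {R : nzRingType} {k : nat} (nu : nat -> R)
    (Z : 'M[R]_(k + k)) :
  \tr (diag2 k nu *m Z) =
  \sum_(j < k) nu j *
    (Z (lshift k j) (lshift k j) + Z (rshift k j) (rshift k j)).
Proof.
rewrite /mxtrace big_split_ord /= -big_split /=; apply: eq_bigr => j _.
rewrite diag2E mul_diag_mx mxE row_mxEl mxE [X in _ + X]mxE row_mxEr mxE.
by rewrite mulrDr.
Qed.

Lemma mxtrace_split {R : nzRingType} {k : nat} (Z : 'M[R]_(k + k)) :
  \tr Z =
  \sum_(j < k) (Z (lshift k j) (lshift k j) + Z (rshift k j) (rshift k j)).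
Proof. by rewrite /mxtrace big_split_ord /= -big_split. Qed.

(* The decomposition of a real-linear map into its complex-linear and
   antilinear parts. *)
Lemma linear_antilinear_gram {R : realFieldType} {p q : nat} (Jp : 'M[R]_p)
    (Jq : 'M[R]_q) (Y : 'M[R]_(p, q)) :
  cplx_structure Jp -> cplx_structure Jq -> Y^T *m Jp *m Y = Jq ->
  let P := 2^-1 *: (Y - Jp *m Y *m Jq) in
  let Q := 2^-1 *: (Y + Jp *m Y *m Jq) in
  P^T *m P = 1%:M + Q^T *m Q.
Proof.
move=> [JpT JpJp] [JqT JqJq] YJY P Q.
rewrite /P /Q ![(_ *: _)^T]linearZ /= -!(scalemxAl, scalemxAr) !scalerA
  polarization_mx.
have -> : Y^T *m (Jp *m Y *m Jq) = - 1%:M by rewrite !mulmxA YJY.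
have -> : (Jp *m Y *m Jq)^T *m Y = - 1%:M.
  by rewrite !trmx_mul JpT JqT !(mulmxN, mulNmx) opprK -!mulmxA (mulmxA Y^T)
    YJY.
rewrite scalerBr addrC; congr (_ + _).
by apply/matrixP => i j; rewrite !mxE; field.
Qed.

(** With Z = Y^T D Y, the mixed terms cancel and the two parts add up to half of Z - Jq Z Jq. By
    cyclicity -Jq Z Jq has the same trace against [N] as Z, since [N] commutes with [Jq] and Jq^2 =
    -1. *)
Lemma linear_antilinear_trace {R : realFieldType} {p q : nat} (Jp D : 'M[R]_p)
    (Jq N : 'M[R]_q) (Y : 'M[R]_(p, q)) :
  cplx_structure Jp -> cplx_structure Jq ->
  D *m Jp = Jp *m D -> N *m Jq = Jq *m N ->
  let P := 2^-1 *: (Y - Jp *m Y *m Jq) in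
  let Q := 2^-1 *: (Y + Jp *m Y *m Jq) in
  \tr (N *m (Y^T *m D *m Y)) =
  \tr (N *m (P^T *m D *m P)) + \tr (N *m (Q^T *m D *m Q)).
Proof.
move=> [JpT JpJp] [JqT JqJq] DJ NJ P Q.
rewrite -mxtraceD -mulmxDr /P /Q ![(_ *: _)^T]linearZ /=
  -!(scalemxAl, scalemxAr) !scalerA.
rewrite -scalerDr parallelogram_mx.
have -> : (Jp *m Y *m Jq)^T *m D *m (Jp *m Y *m Jq) =
    - (Jq *m (Y^T *m D *m Y) *m Jq).
  rewrite !trmx_mul JpT JqT !(mulmxN, mulNmx) opprK -!mulmxA.
  by rewrite (mulmxA D Jp) DJ -(mulmxA Jp D) (mulmxA Jp Jp) JpJp
    !(mulNmx, mulmxN) mul1mx.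
move: (Y^T *m D *m Y) => Z.
have -> : \tr (N *m ((2^-1 * 2^-1) *: ((Z - Jq *m Z *m Jq) *+ 2))) =
    2^-1 * (\tr (N *m Z) - \tr (N *m (Jq *m Z *m Jq))).
  rewrite -scaler_nat scalerA -scalemxAr mxtraceZ mulmxBr.
  by rewrite [\tr (_ - _)]linearB /=; field.
have -> : \tr (N *m (Jq *m Z *m Jq)) = - \tr (N *m Z).
  rewrite mulmxA mxtrace_mulC -linearN /=; congr (\tr _).
  by rewrite !mulmxA -NJ -(mulmxA N) JqJq mulmxN mulmx1 mulNmx.
by field.
Qed.

Lemma linear_of_antilinear0 {R : comNzRingType} {p q : nat} (Jp : 'M[R]_p)
    (Jq : 'M[R]_q) (Y : 'M[R]_(p, q)) :
  cplx_structure Jq ->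
  Y + Jp *m Y *m Jq = 0 -> Y *m Jq = Jp *m Y.
Proof.
move=> [_ JqJq] /(congr1 (mulmx^~ Jq)) /=.
rewrite mul0mx mulmxDl -mulmxA JqJq mulmxN mulmx1.
by move/eqP; rewrite subr_eq0 => /eqP.
Qed.

(** * Weighted sums and Ky Fan bounds over column pairs *)

Lemma increasing_gt0 {R : realFieldType} {k : nat} (nu : nat -> R) :
  0 < nu 0%N -> (forall i, (i.+1 < k)%N -> nu i < nu i.+1) ->
  forall i, (i < k)%N -> 0 < nu i.
Proof.
move=> nu0 nuS; elim=> // i IH ik; apply: lt_trans (nuS i ik).
exact/IH/ltnW.
Qed.

(** Reversing the columns makes the weights decreasing, and the tail hypothesis makes the partial
    sums of the excess of [h] over 2 d nonnegative, as [abel_ge0] requires. At equality all partial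
    sums vanish, and consecutive differences give each [h j]. *)
Lemma weighted_tail_sums {R : realFieldType} {k : nat} (nu d : nat -> R)
    (h : 'I_k -> R) :
  (0 < k)%N -> 0 < nu 0%N -> (forall i, (i.+1 < k)%N -> nu i < nu i.+1) ->
  (forall m (mk : (m <= k)%N),
     2 * \sum_(i < m) d i <= \sum_(i < m) h (rev_ord (widen_ord mk i))) ->
  let val := 2 * \sum_(i < k) d i * nu (k - 1 - i)%N in
  val <= \sum_(j < k) nu j * h j /\
  (\sum_(j < k) nu j * h j <= val -> forall j : 'I_k, h j = 2 * d (k - 1 -
    j)%N).
Proof.
case: k h => // k h _ nu0 nuS tails val.
have nuP := increasing_gt0 _ nu0 nuS.
(* [inord] extends the excess to all naturals; it is only read below the number of columns, where
   [inord] is faithful. *)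
pose F i := h (rev_ord (inord i)) - 2 * d i.
have sumF m : (m <= k.+1)%N -> 0 <= \sum_(i < m) F i.
  move=> mk; rewrite sumrB -mulr_sumr subr_ge0.
  apply: le_trans (tails m mk) _; rewrite le_eqVlt; apply/orP; left.
  apply/eqP; apply: eq_bigr => i _; congr (h (rev_ord _)).
  by apply: val_inj; rewrite /= inordK // (leq_trans (ltn_ord i) mk).
have E : \sum_(j < k.+1) nu j * h j - val = \sum_(i < k.+1) nu (k - i)%N * F i.
  rewrite (reindex_inj rev_ord_inj) /= /val mulr_sumr -sumrB.
  apply: eq_bigr => i _; rewrite /F inord_val subSS subn1 /=; ring.
have [|||A B] := abel_ge0 (fun i => nu (k - i)%N) F k.
- by move=> i ik; apply: nuP; lia.
- move=> i ik; have -> : (k - i = (k - i.+1).+1)%N by lia.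
  by apply: nuS; lia.
- exact: sumF.
have sF := sumF _ (leqnn _).
split.
  rewrite -subr_ge0 E; apply: le_trans A.
  by rewrite mulr_ge0 // ltW // nuP // ltnS leq_subr.
rewrite -subr_le0 E => /B S0 j.
have jk : (k - j < k.+1)%N by rewrite ltnS leq_subr.
have := S0 (k - j).+1 jk; rewrite big_ord_recr /= S0 ?(ltnW jk) // add0r.
move/eqP; rewrite subr_eq0 subSS subn0 => /eqP <-; congr h.
by apply: val_inj; rewrite /= inordK //; have := ltn_ord j; lia.
Qed.

(** [ky_fan_ge] is applied to the selected 2m columns with t the m-th smallest [d]. As each [d]
    occurs twice, 2 m t minus twice the sum of the t - d_i leaves 2 (d_1 + ... + d_m). *)
Lemma ky_fan_symplectic {R : realFieldType} {n k r m : nat} (d : nat -> R)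
    (P : 'M[R]_(n + n, k + k)) (Q : 'M[R]_(r, k + k)) (Z : 'M[R]_(k + k))
    (I : 'I_m -> 'I_k) :
  (m <= n)%N -> (forall i, (i < n)%N -> 0 < d i) ->
  (forall i j, (i <= j < n)%N -> d i <= d j) ->
  P^T *m P = 1%:M + Q^T *m Q -> injective I ->
  Z = P^T *m diag2 n d *m P ->
  2 * \sum_(i < m) d i <=
  \sum_(i < m) (Z (lshift k (I i)) (lshift k (I i))
              + Z (rshift k (I i)) (rshift k (I i))).
Proof.
case: m I => [|m] I mn d0 dS PP Iinj ZE; first by rewrite !big_ord0 mulr0.
pose g := col_index I.
have PgPg : (colsub g P)^T *m colsub g P = 1%:M + (colsub g Q)^T *m colsub g Q.
  have := gram_colsub g P 1%:M; rewrite !mulmx1 => ->.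
  have := gram_colsub g Q 1%:M; rewrite !mulmx1 => ->.
  rewrite PP; apply/matrixP => i j; rewrite [LHS]mxE [LHS]mxE [RHS]mxE.
  rewrite [1%:M _ _]mxE inj_eq; last exact: col_index_inj.
  by rewrite [1%:M _ _]mxE [mxsub _ _ _ _ _]mxE.
(* The positive part of [d m - d i], expressed by comparing indices since [d] is sorted. There are
   now [m.+1] pairs, so [d m] is the threshold. *)
pose e i := if (i < m.+1)%N then d m - d i else 0.
pose e2 (i : 'I_(n + n)) := match split i with inl a => e a | inr a => e a end.
have e2L a : e2 (lshift n a) = e a.
  by rewrite /e2 -[lshift n a]/(unsplit (inl a)) unsplitK.
have e2R a : e2 (rshift n a) = e a.
  by rewrite /e2 -[rshift n a]/(unsplit (inr a)) unsplitK.
have e_ge0 (a : 'I_n) : 0 <= e a.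
  by rewrite /e; case: ifP => // am; rewrite subr_ge0 dS //; lia.
have e_ge (a : 'I_n) : d m - d a <= e a.
  rewrite /e; case: ltnP => // am; rewrite subr_le0 dS // ltn_ord andbT; lia.
have := ky_fan_ge _ _ (row_mx (\row_(i < n) d i) (\row_(i < n) d i)) e2 (d m)
  PgPg.
rewrite -diag2E gram_colsub -ZE => KF.
have {KF} : d m *+ (m.+1 + m.+1) - \sum_i e2 i <= \tr (mxsub g g Z).
  apply: KF => i; case: (split_ordP i) => a ->;
    rewrite ?e2L ?e2R ?row_mxEl ?row_mxEr ?mxE //; exact/ltW/d0.
have -> : \tr (mxsub g g Z) = \sum_(i < m.+1)
    (Z (lshift k (I i)) (lshift k (I i)) + Z (rshift k (I i)) (rshift k (I i))).
  rewrite mxtrace_split; apply: eq_bigr => i _.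
  by rewrite mxE [X in _ + X]mxE /g col_indexL col_indexR.
apply: le_trans; rewrite big_split_ord /= opprD addrA.
rewrite (eq_bigr (fun a : 'I_n => e a)) => [|a _]; last exact: e2L.
rewrite [X in _ - X](eq_bigr (fun a : 'I_n => e a)) => [|a _]; last exact: e2R.
have -> : \sum_(i < n) e i = \sum_(i < m.+1) (d m - d i).
  rewrite -(big_mkord xpredT e) (big_cat_nat _ mn) //= [X in _ + X]big_nat_cond.
  rewrite [X in _ + X]big1 ?addr0; last first.
    by move=> i; rewrite andbT /e => /andP[mi _]; rewrite ltnNge mi.
  by rewrite big_mkord; apply: eq_bigr => i _; rewrite /e ltn_ord.
rewrite sumrB sumr_const card_ord -mulr_natr -[d m *+ _]mulr_natr natrD.
rewrite le_eqVlt; apply/orP; left; apply/eqP; ring.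
Qed.

(** * Rayleigh quotients and extension to a unitary matrix *)

Lemma gram_entry {R : comNzRingType} {p q r : nat} (A : 'M[R]_(p, q))
    (B : 'M[R]_(p, r)) i j :
  ((A *m delta_mx i (0 : 'I_1))^T *m (B *m delta_mx j (0 : 'I_1))) 0 0 =
  (A^T *m B) i j.
Proof.
rewrite -!colE !mxE; apply: eq_bigr => l _.
by rewrite !mxE.
Qed.

Lemma delta_entry {R : comNzRingType} {p : nat} (v : 'cV[R]_p) i :
  ((delta_mx i (0 : 'I_1))^T *m v) 0 0 = v i 0.
Proof. by rewrite trmx_delta -rowE mxE. Qed.

(** The sum of (d_i - c) x_i^2 is zero and its terms are nonnegative, so [x] is supported where d_i
    = c. *)
Lemma rayleigh_eigen {R : realFieldType} {p : nat} (d : 'rV[R]_p) (x : 'cV[R]_p)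
    (c : R) :
  (forall i, x i 0 != 0 -> c <= d 0 i) -> x^T *m x = 1%:M ->
  (x^T *m diag_mx d *m x) 0 0 = c -> diag_mx d *m x = c *: x.
Proof.
move=> dx xx xdx.
have S0 : \sum_i (d 0 i - c) * x i 0 ^+ 2 = 0.
  have -> : \sum_i (d 0 i - c) * x i 0 ^+ 2 =
      (x^T *m diag_mx d *m x) 0 0 - c * (x^T *m x) 0 0.
    rewrite -mulmxA mul_diag_mx !mxE mulr_sumr -sumrB.
    by apply: eq_bigr => i _; rewrite !mxE; ring.
  by rewrite xdx xx mxE eqxx mulr1 subrr.
have S1 i : true -> 0 <= (d 0 i - c) * x i 0 ^+ 2.
  move=> _; have [->|/dx h] := eqVneq (x i 0) 0.
    by rewrite expr0n mulr0.
  by rewrite mulr_ge0 ?sqr_ge0 // subr_ge0.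
apply/colP => i; rewrite mul_diag_mx !mxE.
have /eqP : (d 0 i - c) * x i 0 ^+ 2 = 0 by apply: (psumr_eq0P S1 S0).
rewrite mulf_eq0 subr_eq0 sqrf_eq0 => /orP[/eqP -> // | /eqP ->].
by rewrite !mulr0.
Qed.

(** Induction on the number of columns already moved to basis vectors. Only left halves of pairs
    need care: the right halves follow because [V] and [Y] intertwine the complex structures. *)
Lemma unitary_extension {R : realFieldType} {n k : nat} (d : nat -> R)
    (I : 'I_k -> 'I_n) (Y : 'M[R]_(n + n, k + k)) :
  (forall i j, (i <= j < n)%N -> d i <= d j) ->
  (forall j, I j = (k - 1 - j)%N :> nat) ->
  Y^T *m Y = 1%:M -> Y *m Jmx R k = Jmx R n *m Y ->
  (forall j, (Y^T *m diag2 n d *m Y) (lshift k j) (lshift k j) = d (I j)) ->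
  exists V : 'M[R]_(n + n),
    [/\ V^T *m V = 1%:M, V *m Jmx R n = Jmx R n *m V,
        V *m diag2 n d = diag2 n d *m V & V *m Y = colsub (col_index I) 1%:M].
Proof.
move=> dS IE YY YJ dY.
have [JT JJ] := @Jmx_cplx R n.
pose el (a : 'I_n) : 'cV[R]_(n + n) := delta_mx (lshift n a) 0.
pose er (a : 'I_n) : 'cV[R]_(n + n) := delta_mx (rshift n a) 0.
pose y (j : 'I_k) : 'cV[R]_(n + n) := Y *m delta_mx (lshift k j) 0.
have erE a : er a = - (Jmx R n *m el a) by rewrite Jmx_delta opprK.
suff step m : (m <= k)%N -> exists V : 'M[R]_(n + n),
    [/\ V^T *m V = 1%:M, V *m Jmx R n = Jmx R n *m V,
      V *m diag2 n d = diag2 n d *m V &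
      forall j, (I j < m)%N -> V *m y j = el (I j)].
  have [V [VV VJ VD Vy]] := step k (leqnn k).
  have Ik j : (I j < k)%N by rewrite IE; have := ltn_ord j; lia.
  exists V; split=> //; apply/matrixP => i c.
  suff /colP/(_ i) : col c (V *m Y) = col c (colsub (col_index I) 1%:M).
    by rewrite mxE [RHS]mxE.
  rewrite col_colsub !colE mul1mx -mulmxA.
  case: (split_ordP c) => j ->; first by rewrite col_indexL Vy.
  rewrite col_indexR -[delta_mx (rshift k j) 0]opprK -Jmx_delta mulmxN.
  by rewrite mulmxA YJ -mulmxA mulmxN mulmxA VJ -mulmxA Vy // -erE.
elim: m => [|m IH] mk.
  by exists 1%:M; split=> //; rewrite ?trmx1 ?mulmx1 ?mul1mx.
have [V [VV VJ VD Vy]] := IH (ltnW mk).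
(* The next column, counted from the last one; its target is the basis vector of index m. *)
have jk : (k - 1 - m < k)%N by lia.
pose j := Ordinal jk.
have Ij : I j = m :> nat by rewrite IE /=; lia.
pose x := V *m y j.
have VVm A B : (V *m A)^T *m (V *m B) = A^T *m B :> 'M[R]_1.
  by rewrite trmx_mul -mulmxA (mulmxA V^T) VV mul1mx.
have xx : x^T *m x = 1%:M.
  by rewrite [LHS]mx11_scalar VVm gram_entry YY mxE eqxx.
have prev a : (a < m)%N -> exists2 j' : 'I_k, j' != j & I j' = a :> nat.
  move=> am; have h : (k - 1 - a < k)%N by lia.
  exists (Ordinal h); last by rewrite IE /=; lia.
  by apply/eqP => /(congr1 val) /=; lia.
(* [V] preserves inner products and has sent the earlier columns to basis vectors, so [x] has no
   component along these. *)
have xl (a : 'I_n) : (a < m)%N -> x (lshift n a) 0 = 0.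
  move=> am; have [j' j'j Ij'] := prev a am.
  rewrite -delta_entry -/(el a).
  have -> : a = I j' by apply: val_inj; rewrite /= Ij'.
  rewrite -Vy ?Ij' // VVm gram_entry YY mxE eq_lshift.
  by rewrite (negbTE j'j).
have xr (a : 'I_n) : (a < m)%N -> x (rshift n a) 0 = 0.
  move=> am; have [j' j'j Ij'] := prev a am.
  rewrite -delta_entry -/(er a).
  have -> : a = I j' by apply: val_inj; rewrite /= Ij'.
  have -> : er (I j') = V *m (Y *m delta_mx (rshift k j') 0).
    rewrite erE -Vy ?Ij' // (mulmxA (Jmx R n) V) -VJ -(mulmxA V)
      (mulmxA (Jmx R n) Y) -YJ.
    by rewrite -(mulmxA Y) Jmx_delta !mulmxN opprK.
  by rewrite VVm gram_entry YY mxE eq_rlshift.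
(* On the support of [x] the diagonal is at least [d m], which is also the Rayleigh quotient of
   [x]. *)
have Dx : diag2 n d *m x = d m *: x.
  rewrite diag2E; apply: rayleigh_eigen => //.
    move=> i; case: (split_ordP i) => a -> xa.
      rewrite row_mxEl mxE dS // ltn_ord andbT leqNgt.
      by apply: contra_neqN xa; apply: xl.
    rewrite row_mxEr mxE dS // ltn_ord andbT leqNgt.
    by apply: contra_neqN xa; apply: xr.
  rewrite -diag2E -mulmxA (mulmxA (diag2 n d)) -VD -(mulmxA V) VVm.
  by rewrite /y (mulmxA (diag2 n d)) gram_entry mulmxA dY Ij.
have De (a : 'I_n) : diag2 n d *m el a = d a *: el a.
  apply/colP => i; rewrite diag2E mul_diag_mx mxE [RHS]mxE [el a i 0]mxE.
  case: (split_ordP i) => b ->; rewrite ?eq_lshift ?eq_rlshift ?mulr0 //.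
  by rewrite row_mxEl mxE; case: eqVneq => [->|] //; rewrite !mulr0.
have ee : (el (I j))^T *m el (I j) = 1%:M.
  by rewrite [LHS]mx11_scalar delta_entry mxE !eqxx.
have [||W [WW WJ WD Wx Wz]] := householder _ _ x (el (I j)) (d m)
    (conj JT JJ) _ (diag2_Jmx d) xx ee Dx.
- by rewrite diag2E tr_diag_mx.
- by rewrite De Ij.
exists (W *m V); split.
- by rewrite trmx_mul -mulmxA (mulmxA W^T) WW mul1mx.
- by rewrite -mulmxA VJ mulmxA WJ mulmxA.
- by rewrite -mulmxA VD mulmxA WD mulmxA.
move=> j'; rewrite ltnS leq_eqVlt -mulmxA => /predU1P [Ij' | Ij'].
  have -> : j' = j.
    apply: val_inj => /=; move: Ij'; rewrite IE.
    by have := ltn_ord j'; lia.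
  by rewrite Wx.
have aj : I j' != I j by rewrite -val_eqE /= Ij neq_ltn Ij'.
(* The earlier basis vectors and their images under [Jmx] are orthogonal to [x] and to its target,
   hence [W] fixes them. *)
have orth i : x i 0 = 0 -> el (I j) i 0 = 0 ->
    (x - el (I j))^T *m delta_mx i (0 : 'I_1) = 0.
  move=> xi ei; apply: trmx_inj; rewrite trmx0 trmx_mul trmxK.
  by rewrite [LHS]mx11_scalar delta_entry mxE [X in _ + X]mxE xi ei subrr
    raddf0.
rewrite Vy //; apply: Wz.
  by apply: orth; rewrite ?xl // mxE eq_lshift (negbTE aj).
rewrite -mulmxA Jmx_delta mulmxN orth ?oppr0 ?xr //.
by rewrite mxE eq_rlshift.
Qed.

(** * The bound and its equality case for diag(D, D) *)

Lemma weighted_gram_diag {R : comNzRingType} {p q : nat} (d : 'rV[R]_p)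
    (A : 'M[R]_(p, q)) c :
  (A^T *m diag_mx d *m A) c c = \sum_i d 0 i * A i c ^+ 2.
Proof.
rewrite -mulmxA mul_diag_mx mxE; apply: eq_bigr => i _.
by rewrite !mxE; ring.
Qed.

(** The upper right blocks of the two products are the two diagonal blocks of [Z]. *)
Lemma commute_Jmx_diag {R : comNzRingType} {k : nat} (Z : 'M[R]_(k + k)) :
  Z *m Jmx R k = Jmx R k *m Z ->
  forall j, Z (rshift k j) (rshift k j) = Z (lshift k j) (lshift k j).
Proof.
rewrite -[Z]submxK /Jmx !mulmx_block.
rewrite !(mul0mx, mulmx0, add0r, addr0, mulmx1, mul1mx, mulmxN, mulNmx).
move=> /eq_block_mx [_ -> _ _] j.
by rewrite block_mxEdr block_mxEul.
Qed.

Lemma symplectic_trace_min {R : realFieldType} {n k : nat} (d nu : nat -> R)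
    (Y : 'M[R]_(n + n, k + k)) :
  (0 < k)%N -> (k <= n)%N -> (forall i, (i < n)%N -> 0 < d i) ->
  (forall i j, (i <= j < n)%N -> d i <= d j) ->
  0 < nu 0%N -> (forall i, (i.+1 < k)%N -> nu i < nu i.+1) ->
  Y^T *m Jmx R n *m Y = Jmx R k ->
  let Z := Y^T *m diag2 n d *m Y in
  let val := 2 * \sum_(i < k) d i * nu (k - 1 - i)%N in
  val <= \tr (diag2 k nu *m Z) /\
  (\tr (diag2 k nu *m Z) = val ->
   [/\ Y^T *m Y = 1%:M, Y *m Jmx R k = Jmx R n *m Y &
     forall j, Z (lshift k j) (lshift k j) = d (k - 1 - j)%N]).
Proof.
move=> k0 kn d0 dS nu0 nuS YJY Z val.
have nuP := increasing_gt0 _ nu0 nuS.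
have Jn := @Jmx_cplx R n; have Jk := @Jmx_cplx R k.
pose P := 2^-1 *: (Y - Jmx R n *m Y *m Jmx R k).
pose Q := 2^-1 *: (Y + Jmx R n *m Y *m Jmx R k).
have PP : P^T *m P = 1%:M + Q^T *m Q := linear_antilinear_gram _ _ _ Jn Jk YJY.
have trZ : \tr (diag2 k nu *m Z) = \tr (diag2 k nu *m (P^T *m diag2 n d *m P))
    + \tr (diag2 k nu *m (Q^T *m diag2 n d *m Q)).
  exact: linear_antilinear_trace Jn Jk (diag2_Jmx d) (diag2_Jmx nu).
have QQ c : (Q^T *m diag2 n d *m Q) c c =
    \sum_i (row_mx (\row_(i < n) d i) (\row_(i < n) d i)) 0 i * Q i c ^+ 2.
  by rewrite diag2E weighted_gram_diag.
have dd i : 0 < (row_mx (\row_(i < n) d i) (\row_(i < n) d i)) 0 i.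
  by case: (split_ordP i) => a ->; rewrite ?row_mxEl ?row_mxEr mxE d0.
have Q1 i c : true -> 0 <=
    (row_mx (\row_(i < n) d i) (\row_(i < n) d i)) 0 i * Q i c ^+ 2.
  by rewrite mulr_ge0 ?sqr_ge0 // ltW.
have Q2 c : 0 <= (Q^T *m diag2 n d *m Q) c c.
  by rewrite QQ sumr_ge0 // => i; apply: Q1.
have Q3 (j : 'I_k) : true -> 0 <= nu j *
    ((Q^T *m diag2 n d *m Q) (lshift k j) (lshift k j)
     + (Q^T *m diag2 n d *m Q) (rshift k j) (rshift k j)).
  by move=> _; rewrite mulr_ge0 ?addr_ge0 // ltW // nuP.
have trQ : 0 <= \tr (diag2 k nu *m (Q^T *m diag2 n d *m Q)).
  by rewrite mxtrace_diag2_mul sumr_ge0.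
have [|A B] := weighted_tail_sums nu d
   (fun j => (P^T *m diag2 n d *m P) (lshift k j) (lshift k j)
     + (P^T *m diag2 n d *m P) (rshift k j) (rshift k j)) k0 nu0 nuS.
  move=> m mk.
  (* The reversed indices run through the last m columns. *)
  apply: (ky_fan_symplectic d P Q _ (fun i => rev_ord (widen_ord mk i))) => //.
    exact: leq_trans mk kn.
  by move=> i j /rev_ord_inj /(congr1 (@nat_of_ord k)) /= ij; apply: val_inj.
rewrite -mxtrace_diag2_mul -/val in A B.
split; first by rewrite trZ; lra.
move=> eqv.
(* The value at [P] is already at least [val], so the value at [Q] is zero; since all [nu] and [d]
   involved are positive, every entry of [Q] vanishes. *)
have Q0 : Q = 0.
  have tr0 : \tr (diag2 k nu *m (Q^T *m diag2 n d *m Q)) = 0 by lra.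
  rewrite mxtrace_diag2_mul in tr0.
  apply/matrixP => i c; rewrite [RHS]mxE.
  suff Z0 : (Q^T *m diag2 n d *m Q) c c = 0.
    have /eqP : (row_mx (\row_(i < n) d i) (\row_(i < n) d i)) 0 i * Q i c ^+ 2
      = 0.
      by apply: (psumr_eq0P (fun i => Q1 i c)) => //; rewrite -QQ.
    by rewrite mulf_eq0 (gt_eqF (dd i)) sqrf_eq0 => /eqP.
  have QQ0 (j : 'I_k) :
      (Q^T *m diag2 n d *m Q) (lshift k j) (lshift k j)
      + (Q^T *m diag2 n d *m Q) (rshift k j) (rshift k j) = 0.
    apply/eqP; have /eqP := psumr_eq0P Q3 tr0 (isT : xpredT j).
    by rewrite mulf_eq0 gt_eqF //; apply: nuP.
  case: (split_ordP c) => j ->; apply/eqP; move/eqP: (QQ0 j);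
    by rewrite paddr_eq0 // => /andP[].
have YJ : Y *m Jmx R k = Jmx R n *m Y.
  apply: linear_of_antilinear0 => //; move/eqP: Q0.
  by rewrite scaler_eq0 invr_eq0 pnatr_eq0 => /eqP.
have PY : P = Y.
  rewrite /P -YJ -mulmxA Jk.2 mulmxN mulmx1 opprK.
  by apply/matrixP => i j; rewrite !mxE; field.
rewrite PY -/Z Q0 mulmx0 addr0 in A B PP.
split=> // j.
(* This fixes only the sum of the two diagonal entries of the j-th pair; they are equal because Z
   commutes with [Jmx]. *)
have hj := B _ j.
have ZJ : Z *m Jmx R k = Jmx R k *m Z.
  have JY : Y^T *m Jmx R n = Jmx R k *m Y^T.
    apply: oppr_inj; rewrite -mulmxN -mulNmx -Jn.1 -Jk.1.
    by rewrite -!trmx_mul YJ.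
  by rewrite /Z -!mulmxA YJ (mulmxA (diag2 n d)) diag2_Jmx !mulmxA JY.
have := hj _; rewrite commute_Jmx_diag // eqv lexx => /(_ isT).
lra.
Qed.

Lemma mxtrace_diag2_rev {R : comNzRingType} {k : nat} (d nu : nat -> R) :
  \tr (diag2 k nu *m diag2 k (fun j => d (k - 1 - j)%N)) =
  2 * \sum_(i < k) d i * nu (k - 1 - i)%N.
Proof.
rewrite mxtrace_diag2_mul (reindex_inj rev_ord_inj) mulr_sumr.
apply: eq_bigr => i _; rewrite /diag2 block_mxEul block_mxEdr !mxE eqxx /=.
have -> : (k - 1 - (k - i.+1))%N = i by have := ltn_ord i; lia.
have -> : (k - i.+1)%N = (k - 1 - i)%N by lia.
by rewrite mulr1n; ring.
Qed.

(** * Return from diag(D, D) to the matrix M *)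

Theorem theorem3p5 (R : realType) (n k : nat) (M : 'M[R]_(n + n))
    (d nu : nat -> R) :
  (1 <= k)%N -> (k <= n)%N ->
  posdef_mx M ->
  symp_eigenvalues M d ->
  (0 < nu 0%N) -> (forall i, (i.+1 < k)%N -> nu i < nu i.+1) ->
  let Nt := diag2 k nu in
  let val := 2 * \sum_(i < k) d i * nu (k - 1 - i)%N in
  (* the minimum is attained *)
  (exists X : 'M[R]_(n + n, k + k),
      X^T *m Jmx R n *m X = Jmx R k /\ \tr (Nt *m X^T *m M *m X) = val) /\
  (* it is a lower bound over the feasible set *)
  (forall X : 'M[R]_(n + n, k + k),
      X^T *m Jmx R n *m X = Jmx R k -> val <= \tr (Nt *m X^T *m M *m X)) /\
  (* characterization of minimizers *)
  (forall X : 'M[R]_(n + n, k + k),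
      X^T *m Jmx R n *m X = Jmx R k -> \tr (Nt *m X^T *m M *m X) = val ->
      (exists (S : 'M[R]_(n + n)) (I : 'I_k -> 'I_n),
          williamson M S d /\ injective I /\
          (forall j : 'I_k, d (I j) = d (k - 1 - j)%N) /\ X = SI S I) /\
      X^T *m M *m X = diag2 k (fun j => d (k - 1 - j)%N)).
Proof.
move=> k0 kn _ [d0 [dS [S0 [S0J S0M]]]] nu0 nuS Nt val.
have idx (j : 'I_k) : (k - 1 - j < n)%N by lia.
(* Reversed order, so that the eigenvalues come out nonincreasing. *)
pose I (j : 'I_k) := Ordinal (idx j).
have Iinj : injective I.
  move=> i j /(congr1 (@nat_of_ord n)) /= ij; apply: val_inj => /=.
  by have := ltn_ord i; have := ltn_ord j; lia.
have SIJ S : symplectic S -> (SI S I)^T *m Jmx R n *m SI S I = Jmx R k.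
  by rewrite /symplectic gram_colsub => ->; rewrite mxsub_Jmx.
have SIM S : williamson M S d ->
    (SI S I)^T *m M *m SI S I = diag2 k (fun j => d (k - 1 - j)%N).
  by case=> _; rewrite gram_colsub => ->; apply: mxsub_diag2.
have [JT JJ] := @Jmx_cplx R n.
(* The inverse of a symplectic S is - J S^T J. *)
have S0inv : S0 *m (- (Jmx R n *m S0^T *m Jmx R n)) = 1%:M.
  apply: mulmx1C.
  by rewrite mulNmx -!mulmxA (mulmxA S0^T) S0J JJ opprK.
have reduce X : X^T *m Jmx R n *m X = Jmx R k ->
    exists2 Y, X = S0 *m Y & Y^T *m Jmx R n *m Y = Jmx R k.
  move=> XJ; pose Y := - (Jmx R n *m S0^T *m Jmx R n) *m X.
  have XE : X = S0 *m Y by rewrite /Y mulmxA S0inv mul1mx.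
  by exists Y => //; rewrite -XJ [in RHS]XE (trmx_mul S0) -{1}S0J !mulmxA.
have trE Y : \tr (Nt *m (S0 *m Y)^T *m M *m (S0 *m Y)) =
    \tr (Nt *m (Y^T *m diag2 n d *m Y)).
  by rewrite trmx_mul -S0M !mulmxA.
split.
  exists (SI S0 I); split; first exact: SIJ.
  by rewrite -!mulmxA [X in Nt *m X]mulmxA SIM // mxtrace_diag2_rev.
split=> X XJ; have [Y -> YJ] := reduce X XJ; rewrite trE;
  have [bound eqcase] := symplectic_trace_min d nu Y k0 kn d0 dS nu0 nuS YJ.
  exact: bound.
move=> /eqcase [YY YJc dY].
have [V [VV VJ VD VY]] := unitary_extension d I Y dS (fun=> erefl) YY YJc dY.
have VVt : V *m V^T = 1%:M by apply: mulmx1C.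
have conjV Z : V *m Z = Z *m V -> V *m Z *m V^T = Z.
  by move=> ->; rewrite -mulmxA VVt mulmx1.
(* Inserting V^T V = 1 between [S0] and [Y] exhibits the minimizer as columns of S0 V^T. This is
   again a Williamson diagonalizer, since [V] is orthogonal and commutes with both [Jmx] and
   [diag2 n d]. *)
have XS : S0 *m Y = SI (S0 *m V^T) I.
  by rewrite /SI -[S0 *m V^T]mulmx1 -mulmx_colsub -VY -!mulmxA (mulmxA V^T) VV
    mul1mx.
have W : williamson M (S0 *m V^T) d.
  split; rewrite /symplectic trmx_mul trmxK !mulmxA.
    by rewrite -(mulmxA V) -(mulmxA V) S0J conjV.
  by rewrite -(mulmxA V) -(mulmxA V) S0M conjV.
split; first by exists (S0 *m V^T), I; split=> //; split.
by rewrite XS SIM.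
Qed.
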